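(* For each $N\ge1$ let $\xi_N(\sigma)$, $\sigma\in\{+1,-1\}^N$, be i.i.d. real random variables having a symmetric probability density with support $[-\alpha_N,\alpha_N]$, $0<\alpha_N<\infty$. For $s\ge0$ put $a_N(s)=P\{\xi_N(\sigma)\ge s\}$. Let $H_N(\sigma)=N\xi_N(\sigma)$ and $Z_N(\beta)=\sum_{\sigma\in\{+1,-1\}^N}e^{-\beta H_N(\sigma)}$, $\beta\ge0$. If $\alpha_N\to\alpha\in[0,\infty]$ as $N\to\infty$ and $\frac1N\log a_N(s)\to0$ as $N\to\infty$ for every $0\le s<\alpha$, then $$\lim_{N\to\infty}\frac1N\,E\log Z_N(\beta)=\log2+\alpha\beta.$$
   Context: The value $\alpha=\infty$ is allowed, in which case the right-hand side is understood as $+\infty$ for $\beta>0$ (and $\alpha\beta=0$ for $\beta=0$). $E$ is expectation with respect to the random variables $\xi_N(\sigma)$. *)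

(* Defs.v *)
From HB Require Import structures.
From mathcomp Require Import all_boot all_order all_algebra.
From mathcomp Require Import all_classical all_reals all_analysis.

Set Implicit Arguments.
Unset Strict Implicit.
Unset Printing Implicit Defensive.

Import Order.TTheory GRing.Theory Num.Theory.
Import numFieldNormedType.Exports.

Local Open Scope classical_set_scope.
Local Open Scope ring_scope.

(* The two-point set {+1, -1}, as a finite type. *)
Definition spin : Type := seq_sub [:: (1 : int); (-1 : int)].

Definition config (N : nat) : finType := {ffun 'I_N -> spin}.

Section Probability.
Context {d : measure_display} {T : measurableType d} {R : realType}.
Variable P : probability T R.

Definition mutually_independent (I : finType) (X : I -> {RV P >-> R}) : Prop :=
  forall (J : {set I}) (A : I -> set R),
    (forall i, measurable (A i)) ->
    P (\bigcap_(i in [set` J]) (X i @^-1` A i)) =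
      (\prod_(i in J) P (X i @^-1` A i))%E.

Definition identically_distributed (I : finType) (X : I -> {RV P >-> R}) :
    Prop :=
  forall (i j : I) (A : set R), measurable A ->
    distribution P (X i) A = distribution P (X j) A.

Definition iid (I : finType) (X : I -> {RV P >-> R}) : Prop :=
  mutually_independent X /\ identically_distributed X.

Definition has_density (X : {RV P >-> R}) (f : R -> R) : Prop :=
  [/\ measurable_fun setT f,
      forall x, 0 <= f x &
      forall A : set R, measurable A ->
        distribution P X A = (\int[lebesgue_measure]_(x in A) (f x)%:E)%E].

End Probability.

(* A density is only determined up to a null set, and this is the support of
   the chosen version f.  It contains the support of the law: if the law has
   support S then f can be modified on a null set so that fun_support f = S. *)
Definition fun_support {R : realType} (f : R -> R) : set R :=
  closure [set x | f x != 0].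

Definition hamiltonian {R : realType} {T : Type} (N : nat)
    (xi : config N -> T -> R) (sigma : config N) (w : T) : R :=
  N%:R * xi sigma w.

Definition partition_function {R : realType} {T : Type} (N : nat)
    (H : config N -> T -> R) (beta : R) (w : T) : R :=
  \sum_(sigma : config N) expR (- beta * H sigma w).

(* Main.v *)
Require Import Defs.
From HB Require Import structures.
From mathcomp Require Import all_boot all_order all_algebra.
From mathcomp Require Import all_classical all_reals all_analysis.
From mathcomp Require Import measurable_realfun lra.

Set Implicit Arguments.
Unset Strict Implicit.
Unset Printing Implicit Defensive.

Import Order.TTheory GRing.Theory Num.Theory.
Import numFieldNormedType.Exports.

Local Open Scope classical_set_scope.
Local Open Scope ring_scope.

(** The upper bound is immediate: almost surely every level lies in
    [-alpha_N, alpha_N], hence [|ln Z_N - N ln 2| <= beta N alpha_N].  This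
    also settles the lower bound when alpha = 0 or beta = 0.

    For the lower bound, fix [0 <= s < alpha].  The number of configurations
    with [xi <= - s] has mean about [2^N a_N(s)], which is [2^N] up to a
    subexponential factor by symmetry and the hypothesis on [a_N].  It is a sum
    of independent indicators, so by Chebyshev's inequality it exceeds half its
    mean outside an event of probability [O(1 / (2^N a_N(s)))]
    ([few_occurrences]), and there [ln Z_N] is at least
    [N (ln 2 + beta s - o(1))].

    The delicate point is the exceptional event E: when alpha is infinite,
    alpha_N may grow so fast that [alpha_N * P(E)] is unbounded, and the
    almost sure bound on [ln Z_N] says nothing useful on E.  The way out is to
    set one configuration [sigma0] aside and to count the low levels among the
    others only.  Then E is independent of [xi(sigma0)], and on E we use
    [ln Z_N >= - beta N xi(sigma0)], whose integral over E vanishes because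
    [xi(sigma0)] has a symmetric law ([hits_event_expectation0]).  So the
    exceptional event costs only the factor [1 - P(E)] on the main term, whatever
    the growth of alpha_N ([expectation_ln_partition_ge]). *)

(** * Logarithms of sums of exponentials *)

Section LnSumExp.
Context (R : realType) (I : finType).

Lemma ln_sum_expR_ge_term (x : I -> R) (i : I) : x i <= ln (\sum_j expR (x j)).
Proof.
rewrite -[leLHS]expRK ler_ln ?posrE ?expR_gt0//.
  by rewrite (bigD1 i)//= lerDl sumr_ge0// => j _; exact: expR_ge0.
by rewrite (bigD1 i)//= ltr_pwDl ?expR_gt0// sumr_ge0// => j _; exact: expR_ge0.
Qed.

Lemma ln_sum_expR_ge_card (x : I -> R) (J : {set I}) (c t : R) :
    expR t <= #|J|%:R -> (forall j, j \in J -> c <= x j) ->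
  t + c <= ln (\sum_j expR (x j)).
Proof.
move=> tJ cx; have ht : expR (t + c) <= \sum_j expR (x j).
  rewrite (bigID (mem J))/= ler_wpDr//; first by rewrite sumr_ge0// => j _; exact: expR_ge0.
  rewrite expRD; apply: le_trans (ler_wpM2r (expR_ge0 c) tJ) _.
  rewrite mulr_natl -sumr_const; apply: ler_sum => j jJ.
  by rewrite ler_expR cx.
by rewrite -[leLHS]expRK ler_ln// posrE ?expR_gt0// (lt_le_trans _ ht)// expR_gt0.
Qed.

Lemma ln_sum_expR_bound (i0 : I) (x : I -> R) (c : R) :
  (forall i, `|x i| <= c) -> `|ln (\sum_i expR (x i)) - ln #|I|%:R| <= c.
Proof.
move=> xc; have I0 : 0 < #|I|%:R :> R by rewrite ltr0n; apply/card_gt0P; exists i0.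
rewrite ler_distl; apply/andP; split.
  apply: (@ln_sum_expR_ge_card x [set: I]%SET).
    by rewrite lnK ?posrE// cardsT.
  by move=> i _; have := xc i; rewrite ler_norml => /andP[].
rewrite -[X in _ + X]expRK -lnM ?posrE ?expR_gt0// ler_ln ?posrE ?mulr_gt0 ?expR_gt0//.
  rewrite mulr_natl -sumr_const; apply: ler_sum => i _.
  by rewrite ler_expR (le_trans _ (xc i))// ler_norm.
by rewrite (bigD1 i0)//= ltr_pwDl ?expR_gt0// sumr_ge0// => j _; exact: expR_ge0.
Qed.

End LnSumExp.

(** * Symmetric laws and bounded variables *)

Definition symmetric_law d (T : measurableType d) (R : realType)
    (P : probability T R) (X : T -> R) :=
  forall A : set R, measurable A -> P (X @^-1` (-%R @^-1` A)) = P (X @^-1` A).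

Section RandomVariables.
Context d (T : measurableType d) (R : realType) (P : probability T R).

(** Lebesgue measure is invariant under reflection. *)
Lemma even_density_symmetric_law (X : {RV P >-> R}) (f : R -> R) :
  has_density X f -> (forall x, f (- x) = f x) -> symmetric_law P X.
Proof.
move=> [mf f0 fE] fN A mA.
have mNA : measurable (-%R @^-1` A : set R).
  have mN : measurable_fun [set: R] (-%R : R -> R) by [].
  by rewrite -[X in measurable X]setTI; exact: mN.
rewrite [LHS](fE _ mNA) [RHS](fE _ mA).
under eq_integral do rewrite -fN.
rewrite -(@ge0_integral_pushforward _ _ (measurableTypeR R) (measurableTypeR R)
  R -%R _ lebesgue_measure A (fun x => (f x)%:E))//=.
- by apply: eq_measure_integral => //= B mB _; exact: lebesgue_measureN.
- exact/measurable_EFinP/measurable_funTS.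
- by move=> x _; rewrite lee_fin.
Qed.

Lemma density_ae_bounded (X : {RV P >-> R}) (f : R -> R) (c : R) :
  has_density X f -> fun_support f `<=` `[- c, c] ->
  {ae P, forall w, `|X w| <= c}.
Proof.
move=> [mf f0 fE] fc; exists (X @^-1` (~` `[- c, c])); split.
- by rewrite -[X in measurable X]setTI; apply: measurable_funP => //; exact: measurableC.
- rewrite [LHS]fE; last exact: measurableC.
  apply: integral0_eq => x /= xc; congr (_%:E).
  apply: contrapT => /eqP fx; apply: xc; apply: fc; exact: subset_closure.
- by move=> w /= /negP h; rewrite /= in_itv/= -ler_norml; apply/negP.
Qed.

Lemma ae_bounded_Lfun1 (X : T -> R) (c : R) : measurable_fun [set: T] X ->
  {ae P, forall w, `|X w| <= c} -> X \in Lfun P 1.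
Proof.
move=> mX Xc; apply/Lfun1_integrable/integrableP; split.
  exact/measurable_EFinP.
apply: le_lt_trans (ltry `|c|).
rewrite -[leRHS]mule1 -(probability_setT P) -integral_cst//.
apply: ae_ge0_le_integral => //.
- by apply: measurableT_comp => //; exact/measurable_EFinP.
- by move=> w _; rewrite lee_fin.
- apply: filterS Xc => w Xw _; rewrite lee_fin (le_trans Xw)//; exact: ler_norm.
Qed.

(** Neither variable has a sign, so the almost everywhere monotonicity of
    the integral is applied to the difference, which equals its own absolute
    value almost everywhere. *)
Lemma ae_expectation_le (X Y : T -> R) : X \in Lfun P 1 -> Y \in Lfun P 1 ->
  {ae P, forall w, X w <= Y w} -> ('E_P[X] <= 'E_P[Y])%E.
Proof.
move=> X1 Y1 XY; rewrite -sube_ge0; last by rewrite expectation_fin_num.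
rewrite -expectationB// unlock.
have iYX : P.-integrable [set: T] (EFin \o (Y \- X)).
  by apply/Lfun1_integrable; rewrite rpredB.
have mYX := measurable_int _ iYX.
rewrite (ae_eq_integral (fun w => `|(Y \- X) w|%:E)) //.
- by apply: integral_ge0 => w _; rewrite lee_fin.
- by apply/measurable_EFinP; apply: measurableT_comp => //; exact/measurable_EFinP.
- by apply: filterS XY => w XYw _ /=; rewrite ger0_norm// subr_ge0.
Qed.

(** X and - X have the same image measure, so E[X] = - E[X]; integrability
    makes this number finite. *)
Lemma symmetric_law_expectation0 (X : T -> R) : X \in Lfun P 1 ->
  symmetric_law P X -> ('E_P[X] = 0)%E.
Proof.
move=> X1 Xsym.
have iX := (Lfun1_integrable _ _).1 X1.
have mX : measurable_fun [set: T] X by exact/measurable_EFinP/(measurable_int _ iX).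
pose NX w := - X w.
have mNX : measurable_fun [set: T] NX by exact: measurableT_comp.
have EX : ('E_P[X] = \int[pushforward P X]_x x%:E)%E.
  by rewrite unlock integral_pushforward.
have ENX : ('E_P[NX] = \int[pushforward P NX]_x x%:E)%E.
  rewrite unlock integral_pushforward//.
  by apply/Lfun1_integrable; rewrite rpredN.
have : ('E_P[X] = 'E_P[NX])%E.
  rewrite EX ENX; apply: eq_measure_integral => A mA _; exact/esym/Xsym.
rewrite (_ : NX = (cst 0 \- X)); last by apply/funext => w /=; rewrite sub0r.
rewrite expectationB ?Lfun_cst// expectation_cst sub0e.
rewrite -(fineK (expectation_fin_num X1)) -EFinN => -[] /eqP.
by rewrite -addr_eq0 -mulr2n mulrn_eq0/= => /eqP ->.
Qed.

End RandomVariables.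

(** * Independence of one variable from the hits of the others *)

Section Independence.
Context d (T : measurableType d) (R : realType) (P : probability T R).

Lemma Lfun1_mul_indic (X : T -> R) (C : set T) : X \in Lfun P 1 ->
  measurable C -> X \* \1_C \in Lfun P 1.
Proof.
move=> X1 mC; apply/Lfun1_integrable.
have iX := (Lfun1_integrable _ _).1 X1.
have mX : measurable_fun [set: T] X by exact/measurable_EFinP/(measurable_int _ iX).
apply: le_integrable iX => //.
- by apply/measurable_EFinP; apply: measurable_funM.
- move=> w _ /=; rewrite lee_fin normrM ler_piMr// indicE.
  by case: (_ \in _); rewrite /= ?normr1 ?normr0.
Qed.

(** The variable [X * 1_C] has a symmetric law: on C by independence, and off C
    because it is 0 there. *)
Lemma symmetric_law_mul_indic_expectation0 (X : {RV P >-> R}) (C : set T) :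
    (X : T -> R) \in Lfun P 1 -> symmetric_law P X -> measurable C ->
    (forall A : set R, measurable A ->
      P (X @^-1` A `&` C) = (P (X @^-1` A) * P C)%E) ->
  ('E_P[X \* \1_C] = 0)%E.
Proof.
move=> X1 Xsym mC XC; apply: symmetric_law_expectation0.
  exact: Lfun1_mul_indic.
have mX (A : set R) : measurable A -> measurable (X @^-1` A).
  by move=> mA; rewrite -[X in measurable X]setTI; exact: measurable_funP.
have mN (A : set R) : measurable A -> measurable (-%R @^-1` A).
  have mN : measurable_fun [set: R] (-%R : R -> R) by [].
  by move=> mA; rewrite -[X in measurable X]setTI; exact: mN.
have PXC (A : set R) : measurable A ->
    P ((X \* \1_C) @^-1` A) =
    (P (X @^-1` A) * P C + P (~` C `&` [set _ | A 0%R]))%E.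
  move=> mA; rewrite -XC// -measureU.
  - congr (P _); apply/seteqP; split => w /=; rewrite indicE.
    + have [/set_mem Cw|/negP Cw] := boolP (w \in C).
        by rewrite mulr1; left.
      rewrite mulr0; right; split => //.
      by move=> /mem_set.
    + move=> [[Aw Cw]|[Cw A0]].
        by rewrite (mem_set Cw) mulr1.
      by rewrite (memNset Cw) mulr0.
  - by apply: measurableI => //; exact: mX.
  - apply: measurableI; first exact: measurableC.
    have [A0|A0] := pselect (A 0).
      by rewrite (_ : [set _ | _] = setT)//; apply/seteqP; split.
    by rewrite (_ : [set _ | _] = set0)//; apply/seteqP; split => // x /= /A0.
  - by apply/seteqP; split => // w [[_ ?] []].
move=> A mA; rewrite !PXC//; last exact: mN.
by rewrite Xsym//= oppr0.
Qed.

Variables (I : finType) (X : I -> {RV P >-> R}).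
Hypothesis X_indep : mutually_independent X.

(** The index [i0] is set aside, so that the pattern of hits is independent
    of [X i0]. *)
Definition hits (i0 : I) (B : set R) (w : T) : {set I} :=
  finset (fun i => (i != i0) && (X i w \in B)).

(** Prescribing the exact pattern of hits turns the event into a product event,
    the only kind of event to which mutual independence applies directly. *)
Lemma hits_eqE (i0 : I) (B A : set R) (J : {set I}) : i0 \notin J ->
  X i0 @^-1` A `&` [set w | hits i0 B w = J] =
  \bigcap_(i in [set` [set: I]%SET])
    X i @^-1` (if i == i0 then A else if i \in J then B else ~` B).
Proof.
move=> i0J; apply/seteqP; split => w /=.
  move=> [Aw wJ] i _ /=; case: eqP => [->//|/eqP ii0].
  rewrite -wJ inE ii0/=.
  by case: (boolP (_ \in _)) => [/set_mem//|/negP h]; move: h; rewrite inE.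
move=> h; split; first by have := h i0 (finset.in_setT i0); rewrite eqxx.
apply/setP => i; rewrite inE; have [->|ii0] /= := eqVneq i i0.
  by rewrite (negbTE i0J).
have := h i (finset.in_setT i); rewrite (negbTE ii0).
by case: (i \in J) => h'; [exact/mem_set|exact/memNset].
Qed.

Lemma hits_indep (i0 : I) (B A : set R) (J : {set I}) :
    measurable B -> measurable A ->
  P (X i0 @^-1` A `&` [set w | hits i0 B w = J]) =
  (P (X i0 @^-1` A) * P [set w | hits i0 B w = J])%E.
Proof.
move=> mB mA; have [i0J|i0J] := boolP (i0 \in J).
  rewrite (_ : [set w | _] = set0) ?setI0 ?measure0 ?mule0//.
  apply/seteqP; split => // w /= wJ; move: i0J.
  by rewrite -wJ inE eqxx.
have PE (A' : set R) : measurable A' ->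
    P (X i0 @^-1` A' `&` [set w | hits i0 B w = J]) =
    (P (X i0 @^-1` A') *
     \prod_(i | i != i0) P (X i @^-1` (if i \in J then B else ~` B)))%E.
  move=> mA'; rewrite hits_eqE// X_indep; last first.
    by move=> i; case: ifP => // _; case: ifP => // _; exact: measurableC.
  rewrite (bigD1 i0) ?finset.in_setT//= eqxx; congr (_ * _)%E.
  under eq_bigl do rewrite finset.in_setT.
  by apply: eq_bigr => i /negbTE ->.
rewrite PE//; congr (_ * _)%E.
(* The product over the other indices is the case A = setT of PE. *)
by have := PE _ measurableT; rewrite preimage_setT setTI probability_setT mul1e.
Qed.

Lemma measurable_hits (i0 : I) (B : set R) (J : {set I}) : measurable B ->
  measurable [set w | hits i0 B w = J].
Proof.
move=> mB; have [i0J|i0J] := boolP (i0 \in J).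
  rewrite (_ : [set w | _] = set0)//.
  apply/seteqP; split => // w /= wJ; move: i0J.
  by rewrite -wJ inE eqxx.
have := @hits_eqE i0 B setT J i0J; rewrite preimage_setT setTI => ->.
apply: fin_bigcap_measurable => // i _.
rewrite -[X in measurable X]setTI; apply: measurable_funP => //.
by case: ifP => // _; case: ifP => // _; exact: measurableC.
Qed.

(** An event on the pattern of hits is a finite disjoint union of events that fix
    the whole pattern, each of them independent of [X i0]; the integral of
    [X i0] over each piece is 0. *)
Lemma hits_event_expectation0 (i0 : I) (B : set R) (Q : pred {set I}) :
    (X i0 : T -> R) \in Lfun P 1 -> symmetric_law P (X i0) -> measurable B ->
  ('E_P[X i0 \* \1_[set w | Q (hits i0 B w)]] = 0)%E.
Proof.
move=> X1 Xsym mB.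
rewrite (_ : _ \* _ = fun w =>
    \sum_(J : {set I} | Q J) (X i0 \* \1_[set w | hits i0 B w = J]) w); last first.
  apply/funext => w /=; rewrite -big_distrr/=; congr (_ * _).
  rewrite !indicE; have [/set_mem/= Qw|/negP Qw] := boolP (_ \in _).
    rewrite (bigD1 (hits i0 B w))//= indicE mem_set//= big1 ?addr0// => J /andP[_ Jw].
    by rewrite indicE memNset//= => /eqP; rewrite eq_sym (negbTE Jw).
  rewrite big1// => J QJ; rewrite indicE memNset//= => wJ.
  by apply: Qw; rewrite inE /= wJ.
rewrite unlock; under eq_integral do rewrite -sumEFin.
have mh J : measurable [set w | hits i0 B w = J] by exact: measurable_hits.
rewrite integral_sum//; last first.
  by move=> J; apply/Lfun1_integrable; exact: Lfun1_mul_indic.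
rewrite big1// => J _.
rewrite -[LHS]/(\int[P]_x ((X i0 \* \1_[set w | hits i0 B w = J]) x)%:E)%E.
have := @symmetric_law_mul_indic_expectation0 (X i0) _ X1 Xsym (mh J).
rewrite unlock; apply => A mA; exact: hits_indep.
Qed.

End Independence.

(** * Second moment bound for the number of occurrences *)

Section Counting.
Context d (T : measurableType d) (R : realType) (P : probability T R).

Lemma indic_Lfun1 (A : set T) : measurable A -> (\1_A : T -> R) \in Lfun P 1.
Proof. by move=> mA; apply/Lfun1_integrable; exact: integrable_indic. Qed.

Lemma covariance_indic (A B : set T) : measurable A -> measurable B ->
  (covariance P \1_A \1_B = P (A `&` B) - P A * P B)%E.
Proof.
move=> mA mB.
have ABE : (\1_A * \1_B : T -> R) = \1_(A `&` B) by rewrite indicI.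
rewrite covarianceE ?indic_Lfun1// ABE ?expectation_indic ?indic_Lfun1//;
  exact: measurableI.
Qed.

Variables (I : finType) (Q : pred I) (F : I -> set T).
Hypothesis mF : forall i, measurable (F i).
Hypothesis F_indep : forall i j, i != j ->
  (P (F i `&` F j) = P (F i) * P (F j))%E.

(** The off-diagonal covariances vanish, and the diagonal ones are
    [P(F i) - P(F i)^2]. *)
Lemma expectation_sqr_centered_count :
  ('E_P[fun w => ((\sum_(i | Q i) (\1_(F i) w - fine (P (F i)))) ^+ 2)%R] <=
   \sum_(i | Q i) P (F i))%E.
Proof.
pose Y i : T -> R := \1_(F i) \- cst (fine (P (F i))).
have Y1 i j : (fun w => Y i w * Y j w) \in Lfun P 1.
  apply/Lfun1_integrable; apply: measurable_bounded_integrable => //.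
  - by rewrite (le_lt_trans (probability_le1 P _))// ltry.
  - by apply: measurable_funM; apply: measurable_funB.
  - exists 4; split => // x x4 w _ /=; apply: le_trans (ltW x4).
    have h k : `|Y k w| <= 2.
      rewrite /Y /= (le_trans (ler_normB _ _))// -[2]/(1 + 1) lerD//.
        by rewrite indicE; case: (_ \in _); rewrite /= ?normr1 ?normr0.
      rewrite ger0_norm ?fine_ge0// -lee_fin fineK ?fin_num_measure//.
      exact: probability_le1.
    rewrite normrM (_ : 4 = 2 * 2); last by lra.
    by apply: ler_pM.
have EY i j : ('E_P[fun w => (Y i w * Y j w)%R] = P (F i `&` F j) - P (F i) * P (F j))%E.
  by rewrite -covariance_indic// covariance.unlock !expectation_indic.
rewrite (_ : (fun w => _) = fun w =>
    \sum_(i | Q i) \sum_(j | Q j) Y i w * Y j w); last first.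
  by apply/funext => w; rewrite expr2 big_distrlr.
have -> : ('E_P[fun w => (\sum_(i | Q i) \sum_(j | Q j) (Y i w * Y j w))%R] =
    \sum_(i | Q i) \sum_(j | Q j) 'E_P[fun w => (Y i w * Y j w)%R])%E.
  have iY i j : P.-integrable [set: T] (fun w => (Y i w * Y j w)%:E).
    exact: (Lfun1_integrable _ _).1 (Y1 i j).
  rewrite unlock; under eq_integral do rewrite -sumEFin.
  rewrite integral_sum//; last first.
    move=> i; under eq_fun do rewrite -sumEFin.
    exact: integrable_sum.
  apply: eq_bigr => i _; under eq_integral do rewrite -sumEFin.
  by rewrite integral_sum.
apply: lee_sum => i Qi; rewrite (bigD1 i)//= big1 ?adde0; last first.
  move=> j /andP[_ ji]; rewrite EY F_indep 1?eq_sym// subee//.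
  by rewrite fin_numM ?fin_num_measure.
by rewrite EY setIid leeBlDr ?leeDl ?mule_ge0// fin_numM ?fin_num_measure.
Qed.

(** Chebyshev's inequality: the variance of the count is at most its mean m, and
    the count is further than m / 2 from its mean on this event. *)
Lemma few_occurrences (m : R) : 0 < m ->
    (m%:E = \sum_(i | Q i) P (F i))%E ->
  (P [set w | (\sum_(i | Q i) \1_(F i) w < m / 2)%R] <= (4 / m)%:E)%E.
Proof.
move=> m0 mE; set E := [set w | _].
have mS : measurable_fun [set: T] (fun w => \sum_(i | Q i) (\1_(F i) w : R)).
  rewrite (_ : (fun _ => _) = fun w => \sum_(i <- enum Q) (\1_(F i) w : R)).
    apply: measurable_sum => i; exact: measurable_indic.
  by apply/funext => w; rewrite big_enum.
have mEv : measurable E.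
  rewrite (_ : E = (fun w => \sum_(i | Q i) \1_(F i) w) @^-1` `]-oo, m / 2[).
    by rewrite -[X in measurable X]setTI; exact: mS.
  by apply/seteqP; split => w; rewrite /E/= in_itv.
have sE w : \sum_(i | Q i) (\1_(F i) w - fine (P (F i))) =
    \sum_(i | Q i) \1_(F i) w - m.
  rewrite sumrB; congr (_ - _); apply: EFin_inj; rewrite mE -sumEFin.
  by apply: eq_bigr => i _; rewrite fineK ?fin_num_measure.
have mSm : measurable_fun [set: T]
    (fun w => (\sum_(i | Q i) (\1_(F i) w - fine (P (F i))) : R) ^+ 2).
  under eq_fun do rewrite sE.
  by apply: measurable_funX; apply: measurable_funB.
rewrite -expectation_indic//.
have Em : ((m ^+ 2 / 4)%:E * 'E_P[\1_E] <= m%:E)%E.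
  rewrite mE; apply: le_trans expectation_sqr_centered_count.
  rewrite unlock -ge0_integralZl_EFin//; last 2 first.
  - exact/measurable_EFinP.
  - by rewrite divr_ge0// sqr_ge0.
  apply: ge0_le_integral => //.
  - by move=> w _; rewrite -EFinM lee_fin mulr_ge0// divr_ge0// sqr_ge0.
  - by apply/measurable_EFinP; apply: measurable_funM.
  - exact/measurable_EFinP.
  - move=> w _; rewrite -EFinM lee_fin sE indicE.
    have [/set_mem|_] := boolP (w \in E); last by rewrite mulr0 sqr_ge0.
    rewrite /E /= => Ew; rewrite mulr1; nra.
move: Em; rewrite -lee_pdivlMl; last by rewrite divr_gt0// exprn_gt0.
move=> /le_trans; apply; rewrite -EFinM lee_fin.
by rewrite invf_div expr2 invfM !mulrA mulfVK ?gt_eqF.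
Qed.

End Counting.

(** * Bounds on the expected logarithm of the partition function *)

Section PartitionFunction.
Context d (T : measurableType d) (R : realType) (P : probability T R).
Variables (I : finType) (X : I -> {RV P >-> R}).

Lemma pairwise_independent (B : set R) : mutually_independent X -> measurable B ->
  forall i j, i != j ->
  (P (X i @^-1` B `&` X j @^-1` B) = P (X i @^-1` B) * P (X j @^-1` B))%E.
Proof.
move=> X_indep mB i j ij.
have := X_indep [set i; j]%SET (fun=> B) (fun=> mB).
rewrite big_setU1 ?inE//= big_set1 => <-; congr (P _).
apply/seteqP; split => w /=; last by move=> h; split; apply: h; rewrite /= !inE eqxx ?orbT.
by move=> [wi wj] k /=; rewrite !inE => /orP[] /eqP ->.
Qed.

Lemma card_hits (i0 : I) (B : set R) (w : T) :
  #|hits X i0 B w|%:R = \sum_(i | i != i0) \1_(X i @^-1` B) w :> R.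
Proof.
under eq_bigr do rewrite indicE.
rewrite -natr_sum -sum1_card big_mkcond [in RHS]big_mkcond/=; congr (_%:R).
apply: eq_bigr => i _; rewrite inE.
rewrite (_ : (w \in X i @^-1` B) = (X i w \in B)); last by apply/idP/idP; rewrite !inE.
by case: (i != i0); case: (_ \in _).
Qed.

(** Off the event E that fewer than half the expected number of other levels
    lie below - s, the sum has at least [expR t] terms of size at least
    [expR (b * s)]; on E, only the term of [i0] is kept.  The latter integrates
    to 0, so the bound does not involve the size of the variables. *)
Lemma expectation_ln_partition_ge (i0 : I) (b s t : R) :
    iid X -> symmetric_law P (X i0) -> (X i0 : T -> R) \in Lfun P 1 ->
    (fun w => ln (\sum_i expR (- b * X i w))) \in Lfun P 1 ->
    0 <= b -> 0 <= t + b * s ->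
    2 * expR t <= #|I|.-1%:R * fine (P (X i0 @^-1` `]-oo, - s])) ->
  (((t + b * s) * (1 - 2 * expR (- t)))%:E <=
   'E_P[fun w => ln (\sum_i expR (- b * X i w))%R])%E.
Proof.
move=> [X_indep X_id] Xsym X1 lnZ1 b0 c0 tm.
set B := `]-oo, - s]%classic; set p := fine _ in tm; set m := _ * p in tm.
move: c0; set c := t + b * s => c0; have cE : c = t + b * s by [].
clearbody c.
have mB : measurable B by exact: measurable_itv.
pose E := [set w | (#|hits X i0 B w|%:R < m / 2 :> R)].
have m0 : 0 < m by rewrite (lt_le_trans _ tm)// mulr_gt0// expR_gt0.
have mX i : measurable (X i @^-1` B).
  by rewrite -[X in measurable X]setTI; exact: measurable_funP.
have PE : (P E <= (4 / m)%:E)%E.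
  rewrite /E; under eq_set do rewrite card_hits.
  apply: few_occurrences => //; first exact: pairwise_independent.
  rewrite (eq_bigr (fun=> p%:E)); last first.
    by move=> i _; rewrite [LHS](X_id i i0 _ mB) fineK ?fin_num_measure.
  rewrite sumEFin sumr_const /m mulr_natl; congr (_ *+ _)%:E.
  by rewrite -(cardC1 i0).
have mE : measurable E.
  rewrite (_ : E = (fun w => \sum_(i <- enum (predC1 i0)) (\1_(X i @^-1` B) w : R))
      @^-1` `]-oo, m / 2[); last first.
    by apply/seteqP; split => w; rewrite /E/= in_itv/= card_hits big_enum.
  rewrite -[X in measurable X]setTI.
  have : measurable_fun [set: T]
      (fun w => \sum_(i <- enum (predC1 i0)) (\1_(X i @^-1` B) w : R)).
    by apply: measurable_sum => i; exact: measurable_indic.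
  exact.
have E0 : ('E_P[X i0 \* \1_E] = 0)%E.
  exact: (hits_event_expectation0 X_indep (fun J => #|J|%:R < m / 2) X1 Xsym mB).
have lnZ_ge w : c - (c * \1_E w + b * (X i0 w * \1_E w)) <=
    ln (\sum_i expR (- b * X i w)).
  rewrite indicE; have [/set_mem|/negP wE] := boolP (w \in E).
    move=> _; rewrite !mulr1 opprD addrA subrr sub0r -mulNr.
    exact: (ln_sum_expR_ge_term (fun i => - b * X i w)).
  rewrite !mulr0 addr0 subr0 cE.
  apply: (@ln_sum_expR_ge_card _ _ _ (hits X i0 B w)).
    have : m / 2 <= #|hits X i0 B w|%:R.
      by rewrite leNgt; apply/negP => h; apply: wE; rewrite inE.
    by apply: le_trans; rewrite ler_pdivlMr// mulrC.
  move=> i; rewrite finset.in_set /B => /andP[_ /set_mem/=]; rewrite in_itv/= => Xs.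
  by rewrite mulNr -mulrN ler_wpM2l// lerNr.
have X1E := Lfun1_mul_indic X1 mE.
have L1 : (fun w => c * \1_E w) \in Lfun P 1.
  rewrite (_ : (fun _ => _) = c \o* \1_E); last by apply/funext => w /=; rewrite mulrC.
  by rewrite Lfun_scale// indic_Lfun1.
have L2 : (fun w => b * (X i0 w * \1_E w)) \in Lfun P 1.
  rewrite (_ : (fun _ => _) = b \o* (X i0 \* \1_E)); last by apply/funext => w /=; rewrite mulrC.
  by rewrite Lfun_scale.
have Lw : (cst c \- ((fun w => c * \1_E w) \+ (fun w => b * (X i0 w * \1_E w))))
    \in Lfun P 1.
  by rewrite rpredB ?rpredD ?Lfun_cst.
apply: le_trans (ae_expectation_le Lw lnZ1 (aeW _ lnZ_ge)).
rewrite expectationB ?rpredD ?Lfun_cst// expectationD// expectation_cst.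
rewrite (_ : (fun w => c * \1_E w) = c \o* \1_E); last by apply/funext => w /=; rewrite mulrC.
rewrite (_ : (fun w => b * (X i0 w * \1_E w)) = b \o* (X i0 \* \1_E)); last first.
  by apply/funext => w /=; rewrite mulrC.
rewrite !expectationZl ?indic_Lfun1// E0 mule0 adde0 expectation_indic//.
rewrite -(fineK (fin_num_measure P _ mE)) -EFinM -EFinB lee_fin mulrBr mulr1 lerD2l lerN2.
rewrite ler_wpM2l// -lee_fin fineK ?fin_num_measure//; apply: le_trans PE _.
rewrite lee_fin ler_pdivrMr// expRN.
rewrite mulrAC ler_pdivlMr ?expR_gt0//; nra.
Qed.

End PartitionFunction.

Section BoundedEnergies.
Context d (T : measurableType d) (R : realType) (P : probability T R).
Variables (I : finType) (i0 : I) (X : I -> {RV P >-> R}) (b c : R).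
Hypothesis b0 : 0 <= b.
Hypothesis Xc : forall i, {ae P, forall w, `|X i w| <= c}.

Let lnZ w : R := ln (\sum_i expR (- b * X i w)).

Let lnZ_bound : {ae P, forall w, `|lnZ w - ln #|I|%:R| <= b * c}.
Proof.
have : \forall w \ae P, forall i, `|X i w| <= c by apply: filter_forall.
apply: filterS => w Xwc; apply: ln_sum_expR_bound => // i.
by rewrite normrM normrN (ger0_norm b0) ler_wpM2l.
Qed.

Lemma ln_partition_Lfun1 : lnZ \in Lfun P 1.
Proof.
apply: (@ae_bounded_Lfun1 _ _ _ _ _ (`|ln #|I|%:R| + b * c)).
  apply: measurableT_comp; first exact: measurable_ln.
  apply: measurable_sum => i; apply: measurableT_comp; first exact: measurable_expR.
  by apply: measurable_funM.
apply: filterS lnZ_bound => w h.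
by rewrite -lerBlDl (le_trans (lerB_dist _ _)).
Qed.

Lemma expectation_ln_partition_bound :
  `|fine ('E_P[lnZ])%E - ln #|I|%:R| <= b * c.
Proof.
have L1 := ln_partition_Lfun1.
have Lc k : cst k \in Lfun P 1 by exact: Lfun_cst.
rewrite ler_distl -!lee_fin fineK ?expectation_fin_num//.
rewrite -(expectation_cst P (_ - _)) -(expectation_cst P (_ + _)).
apply/andP; split; apply: ae_expectation_le => //;
  by apply: filterS lnZ_bound => w; rewrite ler_distl => /andP[].
Qed.

End BoundedEnergies.

(** * Passage to the limit *)

Section Limits.
Context (R : realType).

(** The two-sided bound gives the upper limit, and the whole limit as soon as
    [beta * u N] tends to 0; otherwise the lower limit comes from letting s
    increase to alpha. *)
Lemma cvg_of_bounds (g u : nat -> R) (alpha : \bar R) (beta L : R) :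
  (0 <= alpha)%E -> 0 <= beta -> (u N)%:E @[N --> \oo] --> alpha ->
  (\forall N \near \oo, `|g N - L| <= beta * u N) ->
  (forall s, 0 <= s -> (s%:E < alpha)%E -> forall eps, 0 < eps ->
    \forall N \near \oo, L + beta * s - eps <= g N) ->
  (g N)%:E @[N --> \oo] --> (L%:E + alpha * beta%:E)%E.
Proof.
move=> alpha0 beta0 ualpha gL gs.
have [beta00|betaN0] := eqVneq beta 0.
  rewrite beta00 mule0 adde0; apply: cvg_near_cst.
  near=> N; apply/eqP; rewrite eqe -subr_eq0 -normr_le0.
  have : `|g N - L| <= beta * u N by near: N.
  by rewrite beta00 mul0r.
have {betaN0}beta_gt0 : 0 < beta by rewrite lt_def betaN0.
case: alpha alpha0 ualpha gs => [r|_ _ gs|//].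
- rewrite lee_fin => r0 /fine_cvgP[_ /= ur] gs.
  rewrite -EFinM -EFinD; apply/fine_cvgP; split; first exact: nearW.
  apply/cvgrPdist_le => eps eps0 /=.
  have bu : beta * u N @[N --> \oo] --> beta * r by exact: cvgMr.
  have [r00|rN0] := eqVneq r 0.
    near=> N; have h : `|g N - L| <= beta * u N by near: N.
    rewrite r00 mul0r addr0 distrC (le_trans h)//.
    by near: N; apply: cvgr_le bu _ _; rewrite r00 mulr0.
  have r_gt0 : 0 < r by rewrite lt_def rN0.
  pose s := r - Num.min r (eps / 2 / beta).
  have s0 : 0 <= s by rewrite subr_ge0 ge_min lexx.
  have sr : (s%:E < r%:E)%E.
    by rewrite lte_fin ltrBlDr ltrDl lt_min r_gt0 !divr_gt0.
  have bs : beta * r - eps / 2 <= beta * s.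
    rewrite /s mulrBr lerD2l lerN2 -ler_pdivlMl// mulrC ge_min.
    by rewrite lexx orbT.
  near=> N; have h : `|g N - L| <= beta * u N by near: N.
  have h1 : beta * u N <= beta * r + eps.
    by near: N; apply: cvgr_le bu _ _; rewrite ltrDl.
  have h2 : L + beta * s - eps / 2 <= g N.
    by near: N; apply: gs; rewrite ?divr_gt0.
  move: h; rewrite ler_norml ler_norml => /andP[_ h].
  apply/andP; split; lra.
- rewrite gt0_mulye ?lte_fin// addey//; apply/cvgeyPge => A.
  pose s := Num.max 0 ((A + 1 - L) / beta).
  have s0 : 0 <= s by rewrite le_max lexx.
  have bs : A + 1 - L <= beta * s.
    by rewrite mulrC -ler_pdivrMr// le_max lexx orbT.
  near=> N; rewrite lee_fin.
  have h : L + beta * s - 1 <= g N by near: N; apply: gs; rewrite ?ltry.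
  lra.
Unshelve. all: by end_near. Qed.

(** Here [l N] stands for [N^-1 * ln (a N)]; then [expR (N * t N)] is a quarter of
    [2 ^ N * a N], and [N^-1 / t N] bounds [expR (- (N * t N))].
    The quarter absorbs the factor 1 / 2 of Chebyshev's inequality and the
    loss of one configuration out of [2 ^ N]. *)
Lemma entropy_cvg (l : nat -> R) (b : R) : l N @[N --> \oo] --> 0 ->
  let t N := ln 2 - 2 * ln 2 * N%:R^-1 + l N in
  t N @[N --> \oo] --> ln 2 /\
  (t N + b) * (1 - 2 * (N%:R^-1 / t N)) @[N --> \oo] --> ln 2 + b.
Proof.
move=> l0 t.
have iN : N%:R^-1 @[N --> \oo] --> (0 : R).
  by rewrite -(cvg_shiftS (fun N => N%:R^-1 : R)); exact: cvg_harmonic.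
have tL : t N @[N --> \oo] --> ln 2.
  rewrite -[X in _ --> X]addr0; apply: cvgD => //.
  rewrite -[X in _ --> X]subr0; apply: cvgB; first exact: cvg_cst.
  by rewrite -(mulr0 (2 * ln 2)); exact: cvgMr.
split => //.
rewrite -[X in _ --> X]mulr1; apply: cvgM; first by apply: cvgD => //; exact: cvg_cst.
rewrite -[X in _ --> X]subr0; apply: cvgB; first exact: cvg_cst.
rewrite -(mulr0 2); apply: cvgMr; rewrite -(mul0r (ln 2)^-1).
by apply: cvgM => //; apply: cvgV => //; rewrite gt_eqF// ln_gt0// ltr1n.
Qed.

End Limits.

Lemma card_config N : #|config N| = (2 ^ N)%N.
Proof.
by rewrite card_ffun card_ord card_seq_sub.
Qed.

Theorem theorem1p4p1 (R : realType)
  (d : nat -> measure_display) (T : forall N : nat, measurableType (d N))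
  (P : forall N : nat, probability (T N) R)
  (xi : forall N : nat, config N -> {RV (P N) >-> R})
  (f : nat -> R -> R) (alphaN : nat -> R) (a : nat -> R -> \bar R)
  (alpha : \bar R) (beta : R)
  (xi_iid : forall N, (0 < N)%N -> iid (xi N))
  (xi_density : forall N, (0 < N)%N ->
     forall sigma, has_density (xi N sigma) (f N))
  (f_symmetric : forall N, (0 < N)%N -> forall x, f N (- x) = f N x)
  (alphaN_gt0 : forall N, (0 < N)%N -> 0 < alphaN N)
  (f_support : forall N, (0 < N)%N ->
     fun_support (f N) = `[- alphaN N, alphaN N]%classic)
  (aE : forall N, (0 < N)%N -> forall s, 0 <= s -> forall sigma,
     a N s = P N [set w | s <= xi N sigma w])
  (alpha_ge0 : (0 <= alpha)%E)
  (alphaN_cvg : (alphaN N)%:E @[N --> \oo] --> alpha)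
  (a_cvg : forall s, 0 <= s -> (s%:E < alpha)%E ->
     ((N%:R^-1)%:E * lne (a N s))%E @[N --> \oo] --> 0%E)
  (beta_ge0 : 0 <= beta) :
  ((N%:R^-1)%:E *
     'E_(P N)[fun w => ln (partition_function (hamiltonian (xi N)) beta w)])%E
    @[N --> \oo] --> ((ln 2)%:E + alpha * beta%:E)%E.
Proof.
have config_inhab N : inhabited (config N).
  have /card_gt0P[i _] : (0 < #|config N|)%N by rewrite card_config expn_gt0.
  exact: inhabits i.
pose lnZ N w : R := ln (\sum_(sigma : config N) expR (- (beta * N%:R) * xi N sigma w)).
have lnZE N : (fun w => ln (partition_function (hamiltonian (xi N)) beta w)) = lnZ N.
  apply/funext => w; congr ln; apply: eq_bigr => sigma _.
  by rewrite /hamiltonian mulrA mulNr.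
have bN0 N : 0 <= beta * N%:R by rewrite mulr_ge0.
have xi_bounded N (N0 : (0 < N)%N) sigma :
    {ae P N, forall w, `|xi N sigma w| <= alphaN N}.
  apply: density_ae_bounded (xi_density N N0 sigma) _.
  by rewrite (f_support N N0).
have lnZ1 N (N0 : (0 < N)%N) : lnZ N \in Lfun (P N) 1.
  have [i0] := config_inhab N.
  exact: (ln_partition_Lfun1 i0 (bN0 N) (xi_bounded N N0)).
pose g N := N%:R^-1 * fine ('E_(P N)[lnZ N])%E.
have gE N : (0 < N)%N -> (g N)%:E = ((N%:R^-1)%:E * 'E_(P N)[lnZ N])%E.
  by move=> N0; rewrite EFinM fineK// expectation_fin_num// lnZ1.
have gL N : (0 < N)%N -> `|g N - ln 2| <= beta * alphaN N.
  move=> N0; have [i0] := config_inhab N.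
  have := expectation_ln_partition_bound i0 (bN0 N) (xi_bounded N N0).
  rewrite -/(lnZ N) card_config natrX lnXn// => h.
  have N0' : 0 < N%:R :> R by rewrite ltr0n.
  rewrite -(ler_pM2l N0') -{1}(gtr0_norm N0') -normrM mulrBr mulrA divff ?gt_eqF// mul1r.
  by rewrite mulr_natl (le_trans h)// mulrAC mulrC.
(* For N > 0 the expectation is finite, so g has the same limit. *)
suff : (g N)%:E @[N --> \oo] --> ((ln 2)%:E + alpha * beta%:E)%E.
  apply: cvg_trans; apply: near_eq_cvg; near=> N.
  by rewrite gE ?lnZE//; near: N; exact: nbhs_infty_gt.
apply: (cvg_of_bounds (u := alphaN)) => //.
  by near=> N; apply: gL; near: N; exact: nbhs_infty_gt.
move=> s s0 salpha eps eps0.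
have /fine_cvgP[l_fin /= l0] := a_cvg s s0 salpha.
set l := fun N => fine ((N%:R^-1)%:E * lne (a N s))%E in l0.
have ln20 : 0 < ln 2 :> R by rewrite ln_gt0// ltr1n.
have [tL hL] := entropy_cvg (beta * s) l0.
set t := fun N => _ in tL hL.
near=> N.
have N0 : (0 < N)%N by near: N; exact: nbhs_infty_gt.
have N0' : 0 < N%:R :> R by rewrite ltr0n.
have t0 : 0 < t N by near: N; exact: cvgr_gt tL _ ln20.
have lfin : ((N%:R^-1)%:E * lne (a N s))%E \is a fin_num by near: N.
apply: (@le_trans _ _ ((t N + beta * s) * (1 - 2 * (N%:R^-1 / t N)))).
  by near: N; apply: cvgr_ge hL _ _; rewrite ltrBlDr ltrDl.
have [i0] := config_inhab N.
have sym := even_density_symmetric_law (xi_density N N0 i0) (f_symmetric N N0).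
(* The hypothesis concerns high levels; low levels are as likely by symmetry. *)
have aP : a N s = P N (xi N i0 @^-1` `]-oo, - s]).
  rewrite (aE N N0 s s0 i0) -sym; last exact: measurable_itv.
  congr (P N _); apply/seteqP; split => w /=; rewrite in_itv/= lerN2//.
pose p := fine (a N s).
have pE : a N s = p%:E.
  rewrite /p fineK// aP fin_num_measure//.
  by rewrite -[X in measurable X]setTI; apply: measurable_funP => //; exact: measurable_itv.
have p0 : 0 < p.
  (* A null probability has logarithm -oo, whereas the rate is finite. *)
  rewrite ltNge; apply/negP => p0; move: lfin.
  by rewrite pE le0_lneNy ?lee_fin// mulrNy gtr0_sg ?invr_gt0// mul1e.
have lE : N%:R * l N = ln p.
  by rewrite /l pE lne_EFin//= mulrA divff ?gt_eqF// mul1r.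
have et : 4 * expR (N%:R * t N) = 2 ^+ N * p.
  rewrite /t mulrDr mulrBr lE mulrCA divff ?gt_eqF// mulr1.
  have eln k : expR (k%:R * ln 2) = 2 ^+ k :> R.
    by rewrite mulr_natl -lnXn// lnK ?posrE ?exprn_gt0.
  by rewrite expRD expRB lnK ?posrE// !eln; lra.
have := @expectation_ln_partition_ge _ _ _ _ _ (xi N) i0 (beta * N%:R) s (N%:R * t N)
  (xi_iid N N0) sym (ae_bounded_Lfun1 _ (xi_bounded N N0 i0)) (lnZ1 N N0) (bN0 N).
have -> : N%:R * t N + beta * N%:R * s = N%:R * (t N + beta * s).
  by rewrite [RHS]mulrDr mulrA (mulrC beta).
have tb0 : 0 <= t N + beta * s by rewrite addr_ge0 ?mulr_ge0// ltW.
rewrite -aP -/p mulr_ge0// => /(_ _ isT) h.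
have {}h : N%:R * (t N + beta * s) * (1 - 2 * expR (- (N%:R * t N))) <= N%:R * g N.
  rewrite -lee_fin [leRHS]EFinM gE// muleA -EFinM divff ?gt_eqF// mul1e.
  apply: h => //.
  rewrite card_config -subn1 natrB ?expn_gt0// natrX.
  have := et.
  have : 2 <= 2 ^+ N :> R.
    by rewrite -{1}[2]expr1 ler_eXn2l// ltr1n.
  nra.
move: h; rewrite -mulrA ler_pM2l//; apply: le_trans.
(* It remains to see that exp(-x) <= 1 / x for x = N * t N. *)
rewrite ler_wpM2l// lerD2l lerN2 ler_pM2l// expRN -invfM.
rewrite lef_pV2 ?posrE ?expR_gt0 ?mulr_gt0//.
by rewrite (le_trans _ (expR_ge1Dx _))// lerDr.
Unshelve. all: by end_near. Qed.
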